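(* Let $X$ be a finite $2$-distance space with non-zero distances $a$ and $b$, $a<b$, let $n=\#X$, and let $\lambda\Delta$ be a simplex with non-zero distances $\lambda>0$, $m=\#\lambda\Delta$. Let $G$ be the graph with vertex set $X$ whose edges are exactly the pairs of points of $X$ at distance $a$ from each other. Let $k:=k(G)$ be the number of connected components of $G$, and let $\theta:=\theta(G)$ be its clique covering number. Then: 1. If $k=\theta$, then $$ 2d_{GH}(\lambda\Delta,X)= \begin{cases} b&\text{for } m=1,\\ \max\{b,\,\lambda-b\}&\text{for } 1<m<k=\theta,\\ \max\{b-\lambda,\,a,\,\lambda-b\}&\text{for } m=k=\theta,\\ \max\{b-\lambda,\,a,\,\lambda-a\}&\text{for } k=\theta<m<n,\\ \max\{b-\lambda,\,\lambda-a\}&\text{for } m=n,\\ \max\{b-\lambda,\,\lambda\}&\text{for } m>n; \end{cases} $$ 2. If $k<\theta$, then $$ 2d_{GH}(\lambda\Delta,X)= \begin{cases} b&\text{for } m=1,\\ \max\{b,\,\lambda-b\}&\text{for } 1<m\le k,\\ \max\{b,\,\lambda-a\}&\text{for } k<m<\theta,\\ \max\{b-\lambda,\,a,\,\lambda-a\}&\text{for } \theta\le m<n,\\ \max\{b-\lambda,\,\lambda-a\}&\text{for } m=n,\\ \max\{b-\lambda,\,\lambda\}&\text{for } m>n. \end{cases} $$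
   Context: $\#X$ denotes the cardinality of $X$. A finite $2$-distance space with non-zero distances $a<b$ is a finite metric space in which the distances between distinct points take exactly the two values $a$ and $b$ (both occur, $0<a<b$); in particular $\operatorname{diam}X=b$. A simplex is a (non-empty) metric space all of whose non-zero distances are equal; $\lambda\Delta$ denotes a simplex whose non-zero distances equal $\lambda>0$ (its cardinality $m$ is an arbitrary non-zero cardinal, possibly infinite; for $m=1$ it is a single point). $d_{GH}$ denotes the Gromov--Hausdorff distance: $d_{GH}(X,Y)$ is the infimum of all $r$ for which there exist a metric space $Z$ and subsets $X',Y'\subset Z$ isometric to $X$ and $Y$ respectively with Hausdorff distance $d_H(X',Y')\le r$. A clique in a simple graph $H$ is a vertex subset any two distinct elements of which are adjacent (single vertices are cliques). The clique covering number $\theta(H)$ is the minimal number of cliques covering all vertices of $H$ (equivalently, the least number of cliques whose vertex sets partition the vertex set of $H$). *)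

(* Defs.v *)
From HB Require Import structures.
From mathcomp Require Import all_boot all_order all_algebra.
From mathcomp Require Import boolp classical_sets functions cardinality.
From mathcomp Require Import reals constructive_ereal ereal topology.

Set Implicit Arguments.
Unset Strict Implicit.
Unset Printing Implicit Defensive.

Import Order.TTheory GRing.Theory Num.Theory.

Local Open Scope ring_scope.
Local Open Scope classical_set_scope.

Notation "A '#<' B" := ((A #<= B)%card && (A #!= B)%card)
  (at level 79, format "A  '#<'  B") : card_scope.

(* Carries both the distance [mdist] and an enumeration of the points, so that
   [#|X|], [{set X}] and the graph operations of fingraph apply. *)
#[short(type="finMetricType")]
HB.structure Definition FinMetric (R : numDomainType) :=
  {T of Metric R T & Finite T}.

Section Graph.
Variable T : finType.
Implicit Types (e : rel T) (A : {set T}) (P : {set {set T}}).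

Definition clique e A := [forall x in A, forall y in A, (x != y) ==> e x y].

Definition clique_cover e P :=
  (finset.cover P == [set: T]%SET) && [forall A in P, clique e A].

Lemma ex_clique_cover e :
  exists n, [exists P, clique_cover e P && (#|P| == n)].
Proof.
pose P : {set {set T}} := [set [set x]%SET | x in T]%SET.
exists #|P|; apply/existsP; exists P; rewrite eqxx andbT; apply/andP; split.
  apply/eqP/setP => x; rewrite finset.in_setT; apply/bigcupP.
  by exists [set x]%SET; rewrite ?finset.in_set1//; apply: imset_f.
apply/forall_inP => _ /imsetP[x _ ->].
apply/forall_inP => y /finset.set1P ->.
by apply/forall_inP => z /finset.set1P ->; rewrite eqxx.
Qed.

Definition clique_covering_number e := ex_minn (ex_clique_cover e).

(* For symmetric [e]; [n_comp] is only meaningful in that case. *)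
Definition component_number e := n_comp e T.

End Graph.

Section Metric.
Variable R : realType.
Local Open Scope ereal_scope.

Definition isometric_to (X Z : metricType R) (A : set Z) :=
  exists2 f : X -> Z, (forall x y, mdist (f x) (f y) = mdist x y) & range f = A.

(* Extended-real valued, since [A] and [B] may be at infinite distance. *)
Definition hausdorff_dist (Z : metricType R) (A B : set Z) : \bar R :=
  maxe (ereal_sup [set ereal_inf [set (mdist x y)%:E | y in B] | x in A])
       (ereal_sup [set ereal_inf [set (mdist x y)%:E | x in A] | y in B]).

Definition gromov_hausdorff_dist (X Y : metricType R) : \bar R :=
  ereal_inf [set r%:E | r in [set r : R |
    exists (Z : metricType R) (X' Y' : set Z),
      [/\ isometric_to X X', isometric_to Y Y' &
          hausdorff_dist X' Y' <= r%:E]]].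

Definition two_distance_space (a b : R) (X : metricType R) :=
  [/\ (0 < a < b)%R,
      forall x y : X, x <> y -> mdist x y = a \/ mdist x y = b,
      exists x y : X, mdist x y = a &
      exists x y : X, mdist x y = b].

(* [lam] is unconstrained by a one-point [Y]. *)
Definition simplex (lam : R) (Y : metricType R) :=
  [set: Y] !=set0 /\ forall x y : Y, x <> y -> mdist x y = lam.

Definition distance_graph (a : R) (X : finMetricType R) : rel X :=
  [rel x y | mdist x y == a].

End Metric.

(* Main.v *)
Require Import Defs.
From HB Require Import structures.
From mathcomp Require Import all_boot all_order all_algebra.
From mathcomp Require Import boolp classical_sets functions cardinality.
From mathcomp Require Import reals constructive_ereal ereal topology.
From mathcomp Require Import lra.

Set Implicit Arguments.
Unset Strict Implicit.
Unset Printing Implicit Defensive.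

Import Order.TTheory GRing.Theory Num.Theory.

Local Open Scope ring_scope.
Local Open Scope classical_set_scope.
Local Open Scope card_scope.

(** Twice the Gromov-Hausdorff distance of [D] and [X] is the infimum of the
distortions of the correspondences between them: a correspondence of distortion
[2 r] is turned into a metric on the disjoint union in which related points are
at distance [r] ([gromov_hausdorff_le]), and conversely a common ambient space
yields a correspondence by relating the points that are close to each other
([gromov_hausdorff_ge]).  Each value is therefore found by bounding the
distortion on both sides.

Lower bounds.  Let [C] be a correspondence of distortion at most [s], let [k]
be the number of components of the graph [G] of the distance [a], and [theta]
its clique covering number.
- Comparing diameters gives [b - lam <= s], and [lam - b <= s] if [D] has two
  points.
- If [s < a], or [s < lam], then [C] relates distinct points of [X], or of [D],
  to distinct points, which bounds one cardinal by the other.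
- If [s < b], the points of [X] related to a given point of [D] are pairwise at
  distance at most [a], so [#D] cliques cover [X] and [theta <= #D].
- If [s < lam - a], then points of [X] at distance [a] are related to the same
  point of [D], so [C] is constant on components and [#D <= k].

Upper bounds.  When [#D <= #X], the correspondence is the graph of a surjection
[f : X -> D]; if the fibres have diameter at most [u] and points in different
fibres are at distance at least [l], its distortion is at most the maximum of
[u], [lam - l] and [b - lam] ([gromov_hausdorff_le_labelling]).  According to
[#D], the fibres are all of [X] ([u = b]), unions of components ([u = l = b]),
the components themselves when these are cliques ([u = a], [l = b]), arbitrary
([u = b], [l = a]), cliques ([u = l = a]) or points ([u = 0], [l = a]).
Components are grouped by [component_labelling]; the other partitions are
obtained by cutting a coarser one into the required number of pieces
([surjective_refinement]).
When [k = theta] every component is a clique ([component_clique]), which is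
what separates the two parts of the statement.  When [#D > #X], a surjection
from [D] to [X] is used instead. *)

(** * Correspondences and the Gromov-Hausdorff distance *)

Section Correspondence.
Variables (R : realType) (X Y : metricType R).
Implicit Types (C : X -> Y -> Prop) (r s : R).

Definition correspondence C :=
  (forall x, exists y, C x y) /\ (forall y, exists x, C x y).

Definition distortion_le C s :=
  forall x x' y y', C x y -> C x' y' -> `|mdist x x' - mdist y y'| <= s.

(** Distance from [x] to [y] in the disjoint union when one may only cross
between the two spaces along related pairs, at a cost [r]. *)
Definition gluing_dist C r (x : X) (y : Y) : R :=
  inf [set t | exists x' y', C x' y' /\ t = mdist x x' + mdist y y' + r].

Definition gluing_mdist C r (p q : X + Y) : R :=
  match p, q with
  | inl x, inl x' => mdist x x'
  | inr y, inr y' => mdist y y'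
  | inl x, inr y | inr y, inl x => gluing_dist C r x y
  end.

Section Gluing.
Variables (C : X -> Y -> Prop) (r : R).
Hypotheses (hC : correspondence C) (r0 : 0 < r).

Lemma le_gluing_dist t x y :
    (forall x' y', C x' y' -> t <= mdist x x' + mdist y y' + r) ->
  t <= gluing_dist C r x y.
Proof.
move=> tC; apply: lb_le_inf => [|_ [x' [y' [Cxy ->]]]]; last exact: tC.
by have [y' Cxy] := hC.1 x; exists (mdist x x + mdist y y' + r), x, y'.
Qed.

Lemma gluing_dist_le x y x' y' :
  C x' y' -> gluing_dist C r x y <= mdist x x' + mdist y y' + r.
Proof.
move=> Cxy; apply: ge_inf; last by exists x', y'.
by exists 0 => _ [u [v [_ ->]]]; rewrite !addr_ge0 ?mdist_ge0 ?(ltW r0).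
Qed.

Lemma gluing_dist_gt0 x y : 0 < gluing_dist C r x y.
Proof.
apply: (lt_le_trans r0); apply: le_gluing_dist => x' y' _.
by rewrite lerDr addr_ge0 ?mdist_ge0.
Qed.

Lemma gluing_triangle_l x x' y :
  gluing_dist C r x y <= mdist x x' + gluing_dist C r x' y.
Proof.
rewrite -lerBlDl; apply: le_gluing_dist => u v Cuv.
have := gluing_dist_le x y Cuv; have := metric_triangle x x' u; lra.
Qed.

Lemma gluing_triangle_r x y y' :
  gluing_dist C r x y <= gluing_dist C r x y' + mdist y' y.
Proof.
rewrite -lerBlDr; apply: le_gluing_dist => u v Cuv.
have := gluing_dist_le x y Cuv; have := metric_triangle y y' v.
by rewrite (metric_sym y y'); lra.
Qed.

Hypothesis dC : distortion_le C (2 * r).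

(** The path from [x] to [x'] through [y] crosses twice, at a total cost [2 r],
which makes up for the distortion of [C]. *)
Lemma gluing_triangle_inl x x' y :
  mdist x x' <= gluing_dist C r x y + gluing_dist C r x' y.
Proof.
rewrite -lerBlDr; apply: le_gluing_dist => u v Cuv.
rewrite lerBlDr -lerBlDl; apply: le_gluing_dist => u' v' Cuv'.
have := dC Cuv Cuv'; rewrite ler_norml => /andP[_].
have := metric_triangle x u x'; have := metric_triangle u u' x'.
have := metric_triangle v y v'.
rewrite (metric_sym u' x') (metric_sym v y); lra.
Qed.

Lemma gluing_triangle_inr x y y' :
  mdist y y' <= gluing_dist C r x y + gluing_dist C r x y'.
Proof.
rewrite -lerBlDr; apply: le_gluing_dist => u v Cuv.
rewrite lerBlDr -lerBlDl; apply: le_gluing_dist => u' v' Cuv'.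
have := dC Cuv Cuv'; rewrite ler_norml => /andP[+ _].
have := metric_triangle y v y'; have := metric_triangle v v' y'.
have := metric_triangle u x u'.
rewrite (metric_sym v' y') (metric_sym u x); lra.
Qed.

Fact gluing_mdistxx p : gluing_mdist C r p p = 0.
Proof. by case: p => [x|y] /=; rewrite mdistxx. Qed.

Fact gluing_mdist_positivity p q : gluing_mdist C r p q = 0 -> p = q.
Proof.
case: p q => [x|y] [x'|y'] /=.
- by move/mdist_positivity->.
- by move=> g0; have := gluing_dist_gt0 x y'; rewrite g0 ltxx.
- by move=> g0; have := gluing_dist_gt0 x' y; rewrite g0 ltxx.
- by move/mdist_positivity->.
Qed.

Fact gluing_mdist_sym p q : gluing_mdist C r p q = gluing_mdist C r q p.
Proof. by case: p q => [x|y] [x'|y'] //=; exact: metric_sym. Qed.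

Fact gluing_mdist_triangle q p u :
  gluing_mdist C r p u <= gluing_mdist C r p q + gluing_mdist C r q u.
Proof.
case: p q u => [x|y] [x'|y'] [x''|y''] /=; rewrite ?metric_triangle//.
- exact: gluing_triangle_l.
- exact: gluing_triangle_inl.
- exact: gluing_triangle_r.
- by rewrite addrC metric_sym; exact: gluing_triangle_l.
- exact: gluing_triangle_inr.
- by rewrite addrC metric_sym; exact: gluing_triangle_r.
Qed.

Definition gluing : metricType R :=
  HB.pack (X + Y)%type (isMetric.Build R (X + Y)%type
    gluing_mdistxx gluing_mdist_positivity gluing_mdist_sym
    gluing_mdist_triangle).

Lemma gromov_hausdorff_le_gluing : (gromov_hausdorff_dist X Y <= r%:E)%E.
Proof.
apply: ereal_inf_lbound; exists r => //=.
exists gluing, (range (inl : X -> gluing)), (range (inr : Y -> gluing)).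
have near x y : C x y -> (gluing_dist C r x y <= r)%R.
  by move=> /(gluing_dist_le x y); rewrite !mdistxx !add0r.
split; first by exists inl.
  by exists inr.
rewrite /hausdorff_dist ge_max; apply/andP; split.
  apply: ge_ereal_sup => _ [_ [x _ <-] <-].
  have [y Cxy] := hC.1 x; apply: ge_ereal_inf.
  exists (gluing_dist C r x y)%:E; last by rewrite lee_fin near.
  by exists (inr y).
apply: ge_ereal_sup => _ [_ [y _ <-] <-].
have [x Cxy] := hC.2 y; apply: ge_ereal_inf.
exists (gluing_dist C r x y)%:E; last by rewrite lee_fin near.
by exists (inl x).
Qed.

End Gluing.

(** [s] must be positive: related points of the glued space are at distance
[s / 2], and a metric separates points. *)
Lemma gromov_hausdorff_le C s : correspondence C -> distortion_le C s ->
  0 < s -> (2%:E * gromov_hausdorff_dist X Y <= s%:E)%E.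
Proof.
move=> hC dC s0; rewrite -lee_pdivlMl// -EFinM.
apply: (gromov_hausdorff_le_gluing (C := C)) => //; first by rewrite mulr_gt0.
by rewrite mulVKf.
Qed.

(** In an ambient space with Hausdorff distance at most [r], relating the points
at distance less than [r + e] is a correspondence of distortion at most
[2 (r + e)], for every [e > 0]; the slack [e] is there because the infima that
define the Hausdorff distance need not be attained. *)
Lemma gromov_hausdorff_ge t :
    (forall C s, correspondence C -> distortion_le C s -> t <= s) ->
  (t%:E <= 2%:E * gromov_hausdorff_dist X Y)%E.
Proof.
move=> tle; rewrite -lee_pdivrMl// -EFinM.
apply: le_ereal_inf_tmp => _ [r [Z [_ [_ [[f fiso <-] [g giso <-] hr]]]] <-].
rewrite lee_fin; apply/ler_addgt0Pr => e e0.
pose C x y := mdist (f x) (g y) < r + e.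
have re : (r%:E < (r + e)%:E)%E by rewrite lte_fin ltrDl.
move: hr; rewrite /hausdorff_dist ge_max => /andP[hX hY].
suff : t <= 2 * (r + e) by lra.
apply: (tle C); first split.
- move=> x; have [|_ [_ [y _ <-] <-]] := @ereal_inf_lt _
    [set (mdist (f x) z)%:E | z in range g] (r + e)%:E.
    apply: le_lt_trans re; apply: le_trans hX.
    by apply: ereal_sup_ubound; exists (f x) => //; exists x.
  by rewrite lte_fin => xy; exists y.
- move=> y; have [|_ [_ [x _ <-] <-]] := @ereal_inf_lt _
    [set (mdist z (g y))%:E | z in range f] (r + e)%:E.
    apply: le_lt_trans re; apply: le_trans hY.
    by apply: ereal_sup_ubound; exists (g y) => //; exists y.
  by rewrite lte_fin => xy; exists x.
- move=> x x' y y'; rewrite /C -fiso -giso => Cxy Cxy'.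
  have := metric_triangle (f x) (g y) (f x').
  have := metric_triangle (g y) (g y') (f x').
  have := metric_triangle (g y) (f x) (g y').
  have := metric_triangle (f x) (f x') (g y').
  rewrite (metric_sym (g y) (f x)) (metric_sym (g y') (f x')) ler_norml.
  by move=> *; apply/andP; split; lra.
Qed.

Lemma gromov_hausdorff_eq t :
    (2%:E * gromov_hausdorff_dist X Y <= t%:E)%E ->
    (forall C s, correspondence C -> distortion_le C s -> t <= s) ->
  (2%:E * gromov_hausdorff_dist X Y)%E = t%:E.
Proof.
by move=> le ge; apply/eqP; rewrite eq_le le; exact: gromov_hausdorff_ge.
Qed.

End Correspondence.

(** * Cardinals of types *)

Lemma card_le_setTP (T U : Type) :
  [set: T] #<= [set: U] <-> exists f : T -> U, injective f.
Proof.
split=> [/card_leP[f]|[f f_inj]].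
  exists (fun x => val (f (to_setT x))) => x y /val_inj.
  by move=> /inj; rewrite !inE => /(_ I I)/(congr1 val).
rewrite -(card_le_eql (inj_card_eq (A := [set: T]) (f := f) _)) ?card_leT//.
by move=> x y _ _; exact: f_inj.
Qed.

Lemma card_eq_setT_bijective (T U : Type) :
  [set: T] #= [set: U] -> exists f : T -> U, bijective f.
Proof.
have to_setTK (V : Type) (u : [set: V]) : to_setT (val u) = u by exact: val_inj.
move=> /card_bijP[f [g fK gK]].
exists (fun x => val (f (to_setT x))), (fun y => val (g (to_setT y))) => x.
  by rewrite to_setTK fK.
by rewrite to_setTK gK.
Qed.

(** * Partitions, cliques and components of a finite graph *)

(** A partition (the fibres of [c]) can be refined to one with exactly [m]
classes for every [m] between its number of classes and the number of points:
choose a representative of each class, enlarge this set of representatives to a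
set [B] with [m] points, and send every point outside [B] to the representative
of its class. *)
Lemma surjective_refinement (T U : finType) (c : T -> U) m :
    (#|c @: T| <= m <= #|T|)%N ->
  exists2 f : T -> 'I_m, (forall i, exists x, f x = i) &
    forall x y, f x = f y -> c x = c y.
Proof.
case/andP=> cm mT.
(* The picked element only depends on [c x], so [rep] is a transversal. *)
pose rep x := odflt x [pick z | c z == c x].
have c_rep x : c (rep x) = c x.
  by rewrite /rep; case: pickP => [z /eqP|].
have rep_c x y : c x = c y -> rep x = rep y.
  move=> cxy; rewrite /rep cxy; case: pickP => // /(_ y).
  by rewrite eqxx.
pose A := (rep @: T)%SET.
have cardA : #|A| = #|c @: T|.
  have -> : (c @: T = c @: A)%SET.
    apply/setP => u; apply/imsetP/imsetP => -[x _ ->]; last by exists x.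
    by exists (rep x); rewrite ?c_rep ?imset_f.
  rewrite card_in_imset// => _ _ /imsetP[x _ ->] /imsetP[y _ ->].
  by rewrite !c_rep => /rep_c.
have /card_geqP[s [us szs sA]] : (m - #|A| <= #|~: A|)%N.
  by rewrite leq_subLR cardsC.
pose B := (A :|: [set z in s])%SET.
have cardB : #|B| = m.
  rewrite cardsU disjoint_setI0 ?cards0 ?subn0.
    by rewrite cardsE (card_uniqP us) szs subnKC ?cardA.
  rewrite disjoint_sym finset.disjoints_subset; apply/fintype.subsetP => z.
  by rewrite inE => /sA.
pose pi x := if x \in B then x else rep x.
have piB x : pi x \in B.
  by rewrite /pi; case: ifP => // _; rewrite inE imset_f.
have c_pi x : c (pi x) = c x by rewrite /pi; case: ifP.
have [x0|T0] := pickP T; last first.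
  have m0 : m = 0%N by apply/eqP; rewrite -leqn0 (leq_trans mT)// eq_card0.
  exists (fun x => False_rect _ (elimF idP (T0 x) isT)) => [[i]|x].
    by rewrite m0.
  by have := T0 x.
move=> _; have x0B := piB x0.
exists (fun x => cast_ord cardB (enum_rank_in x0B (pi x))) => [i|x y].
  exists (enum_val (cast_ord (esym cardB) i)).
  rewrite /pi enum_valP enum_valK_in; exact: cast_ordKV.
move/cast_ord_inj/(enum_rank_in_inj (piB _) (piB _)) => pixy.
by rewrite -c_pi pixy c_pi.
Qed.

Section Labelling.
Variable T : finType.
Implicit Types (e : rel T) (m : nat).

Lemma clique_covering_number_le e m (f : T -> 'I_m) :
    (forall x y, f x = f y -> x <> y -> e x y) ->
  (clique_covering_number e <= m)%N.
Proof.
move=> fe; pose P := [set [set x | f x == i] | i : 'I_m]%SET.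
have cP : clique_cover e P.
  apply/andP; split.
    apply/eqP/setP => x; rewrite finset.in_setT; apply/bigcupP.
    by exists [set y | f y == f x]%SET; rewrite ?inE ?imset_f.
  apply/forall_inP => _ /imsetP[i _ ->].
  apply/forall_inP => x; rewrite inE => /eqP fx.
  apply/forall_inP => y; rewrite inE => /eqP fy.
  by apply/implyP => /eqP; apply: fe; rewrite fx fy.
rewrite /clique_covering_number; case: ex_minnP => n _ /(_ #|P|) min.
apply: leq_trans (min _) _; first by apply/existsP; exists P; rewrite cP /=.
by rewrite (leq_trans (leq_imset_card _ _))// cardT size_enum_ord.
Qed.

Lemma clique_covering_number_le_card e : (clique_covering_number e <= #|T|)%N.
Proof.
by apply: (@clique_covering_number_le _ _ enum_rank) => x y /enum_rank_inj.
Qed.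

(** A minimal covering by cliques, made into a partition by choosing for every
point a clique that contains it. *)
Lemma clique_labelling e : exists c : T -> {set T},
  (#|c @: T| <= clique_covering_number e)%N /\
  forall x y, c x = c y -> x <> y -> e x y.
Proof.
rewrite /clique_covering_number; case: ex_minnP => n.
case/existsP => P /andP[/andP[/eqP Pcov Pcl] /eqP <-] _.
have cP x : exists A, (A \in P) && (x \in A).
  have : x \in finset.cover P by rewrite Pcov.
  by case/bigcupP => A AP xA; exists A; rewrite AP.
exists (fun x => xchoose (cP x)); split.
  apply: subset_leq_card; apply/fintype.subsetP => _ /imsetP[x _ ->].
  by case/andP: (xchooseP (cP x)).
move=> x y cxy /eqP xy.
have /andP[AP xA] := xchooseP (cP x).
have /andP[_ yA] := xchooseP (cP y); rewrite -cxy in yA.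
move/forall_inP: Pcl => /(_ _ AP)/forall_inP/(_ _ xA)/forall_inP/(_ _ yA).
by rewrite xy.
Qed.

Lemma card_root_imset e : symmetric e ->
  #|fingraph.root e @: T| = component_number e.
Proof.
move=> /sym_connect_sym se; rewrite /component_number /n_comp_mem.
apply: eq_card => x.
apply/imsetP/idP => [[y _ ->]|]; first by rewrite !inE roots_root.
by rewrite !inE andbT => /eqP rx; exists x.
Qed.

(** Grouping the components into [m] blocks: any surjection from the set of
roots onto ['I_m] does it, and it is injective when there are as many blocks as
components. *)
Lemma component_labelling e m : symmetric e ->
    (0 < m <= component_number e)%N ->
  exists f : T -> 'I_m, [/\ forall i, exists x, f x = i,
    forall x y, connect e x y -> f x = f y &
    (component_number e <= m)%N -> forall x y, f x = f y -> connect e x y].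
Proof.
move=> se /andP[m0 mk].
pose S : finType := {x : T | roots e x}.
have cardS : #|S| = component_number e.
  rewrite card_sig /component_number /n_comp_mem.
  by apply: eq_card => x; rewrite !inE andbT.
have [h hsurj hinj] : exists2 h : S -> 'I_m, (forall i, exists x, h x = i) &
    (component_number e <= m)%N -> injective h.
  have [km|mk'] := leqP (component_number e) m.
    have [|h hsurj hinj] := @surjective_refinement S S id m.
      by rewrite card_imset// cardS mk km.
    by exists h.
  have [|h hsurj _] := @surjective_refinement S unit (fun=> tt) m.
    by rewrite cardS mk andbT (leq_trans (max_card _))// card_unit.
  by exists h.
pose q x : S := exist _ (fingraph.root e x) (roots_root (sym_connect_sym se) x).
have qE x y : (q x == q y) = connect e x y.
  by rewrite -(root_connect (sym_connect_sym se)).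
exists (h \o q); split=> [i|x y|km x y].
- have [[x rx] <-] := hsurj i; exists x => /=; congr h.
  exact/val_inj/eqP.
- by rewrite -qE => /eqP /= ->.
- by move=> /(hinj km)/eqP; rewrite qE.
Qed.

(** A clique lies in one component, so a covering by as many cliques as there
are components has exactly one clique in each component. *)
Lemma component_clique e : symmetric e ->
  component_number e = clique_covering_number e ->
  forall x y, connect e x y -> x <> y -> e x y.
Proof.
move=> se kt x y xy nxy; have [c [cn cP]] := clique_labelling e.
have sce := sym_connect_sym se.
apply: (cP x y) => //.
(* [phi] sends a clique to the root of its component; it is onto the roots,
   hence injective by counting. *)
pose phi A := omap (fingraph.root e) [pick z | c z == A].
have phiE z : phi (c z) = Some (fingraph.root e z).
  rewrite /phi; case: pickP => [w /eqP cw|/(_ z)]; last by rewrite eqxx.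
  congr Some; apply/(fingraph.rootP sce).
  by have [->//|/eqP wz] := eqVneq w z; exact/connect1/cP.
have Some_inj : injective (@Some T) by move=> u v [].
have /imset_injP phi_inj : #|phi @: (c @: T)%SET| == #|c @: T|.
  rewrite eqn_leq leq_imset_card (leq_trans cn)//= -kt -card_root_imset//.
  rewrite -(card_imset _ Some_inj) -!imset_comp.
  by apply: subset_leq_card; apply/fintype.subsetP => u /imsetP[z _ ->];
    apply/imsetP; exists z => //=; rewrite phiE.
apply: phi_inj; rewrite ?imset_f// !phiE; congr Some.
exact/(fingraph.rootP sce).
Qed.

End Labelling.

(** * Bounds on the distortion *)

Section TwoDistance.
Variables (R : realType) (a b lam : R) (X : finMetricType R) (D : metricType R).
Hypotheses (hX : two_distance_space a b X) (hlam : 0 < lam).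
Hypothesis hD : simplex lam D.
Local Notation G := (distance_graph a (X := X)).

Lemma distance_graph_sym : symmetric G.
Proof. by move=> x y; rewrite /distance_graph /= metric_sym. Qed.

Lemma two_distance_cases (x y : X) :
  [\/ x = y /\ mdist x y = 0, x <> y /\ mdist x y = a
    | x <> y /\ mdist x y = b].
Proof.
have [<-|/eqP xy] := eqVneq x y; first by constructor 1; rewrite mdistxx.
by have [_ /(_ _ _ xy)[] ? _ _] := hX; [constructor 2|constructor 3].
Qed.

Lemma mdist_le_diam (x y : X) : mdist x y <= b.
Proof.
have [/andP[? ?] _ _ _] := hX.
by have [[_ ->]|[_ ->]|[_ ->]] := two_distance_cases x y; lra.
Qed.

Lemma mdist_ge_min (x y : X) : x <> y -> a <= mdist x y.
Proof.
have [/andP[? ?] _ _ _] := hX.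
by have [[->]|[_ ->]|[_ ->]] := two_distance_cases x y => //; lra.
Qed.

Lemma mdist_le_min (x y : X) : (x <> y -> G x y) -> mdist x y <= a.
Proof.
have [/andP[? ?] _ _ _] := hX; rewrite /distance_graph /=.
have [[_ ->]|[? ->]|[? ->]] := two_distance_cases x y; try lra.
by move=> /(_ _)/eqP ->.
Qed.

Lemma mdist_component (x y : X) : ~ connect G x y -> b <= mdist x y.
Proof.
have [[->]|[_ xy]|[_ ->]] := two_distance_cases x y => //.
by case; apply: connect1; rewrite /distance_graph /= xy.
Qed.

Lemma simplex_cases (p q : D) :
  p = q /\ mdist p q = 0 \/ p <> q /\ mdist p q = lam.
Proof.
have [<-|/eqP pq] := eqVneq p q; first by left; rewrite mdistxx.
by right; split=> //; apply: hD.2.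
Qed.

(** Two points at distance [a] share their root, so [root] is not injective. *)
Lemma component_number_lt_card : (component_number G < #|X|)%N.
Proof.
have [/andP[a0 _] _ [x [y xy]] _] := hX.
have se := distance_graph_sym.
rewrite -(card_root_imset se) ltn_neqAle leq_imset_card andbT.
apply/negP => /imset_injP inj_root.
suff exy : x = y by move: a0; rewrite -xy exy mdistxx ltxx.
apply: inj_root => //; apply/(fingraph.rootP (sym_connect_sym se)).
by apply: connect1; rewrite /distance_graph /= xy.
Qed.

Section LowerBounds.
Variables (C : D -> X -> Prop) (s : R).
Hypotheses (hC : correspondence C) (dC : distortion_le C s).

Lemma distortion_same p x y : C p x -> C p y -> mdist x y <= s.
Proof.
move=> Cx Cy; have := dC Cx Cy.
by rewrite mdistxx sub0r normrN ger0_norm ?mdist_ge0.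
Qed.

Lemma distortion_ge_diam_point : (forall p q : D, p = q) -> b <= s.
Proof.
move=> D1; have [_ _ _ [x [y <-]]] := hX.
have [p Cpx] := hC.2 x; have [q Cqy] := hC.2 y.
by apply: (@distortion_same p) => //; rewrite (D1 p q).
Qed.

Lemma distortion_ge_diam : b - lam <= s.
Proof.
have [_ _ _ [x [y xy]]] := hX.
have [p Cpx] := hC.2 x; have [q Cqy] := hC.2 y.
have := dC Cpx Cqy; rewrite ler_norml xy => /andP[+ _].
by have l0 := hlam; have [[_ ->]|[_ ->]] := simplex_cases p q; lra.
Qed.

Lemma distortion_ge_edge (p q : D) : p <> q -> lam - b <= s.
Proof.
move=> pq; have [x Cpx] := hC.1 p; have [y Cqy] := hC.1 q.
have [/andP[? ?] _ _ _] := hX.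
have := dC Cpx Cqy; rewrite ler_norml hD.2// => /andP[_].
by have [[_ ->]|[_ ->]|[_ ->]] := two_distance_cases x y; lra.
Qed.

Lemma distortion_ge_a m (beta : 'I_m -> D) : bijective beta ->
  (m < #|X|)%N -> a <= s.
Proof.
case=> inv betaK invK mn; rewrite leNgt; apply/negP => sa.
have [f Cf] := choice hC.2.
suff inj_f : injective (inv \o f).
  by move: mn; rewrite ltnNge -[m in (_ <= m)%N]card_ord (leq_card _ inj_f).
move=> x y /(can_inj invK) fxy; have [/andP[? ?] _ _ _] := hX.
have := Cf y; rewrite -fxy => /(distortion_same (Cf x)).
by have [[-> _//]|[_ ->]|[_ ->]] := two_distance_cases x y => ?; exfalso; lra.
Qed.

Lemma injection_of_distortion_lt_lam :
  s < lam -> exists g : D -> X, injective g.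
Proof.
move=> slam; have [g Cg] := choice hC.1; exists g => p q gpq.
have := Cg q; rewrite -gpq => /(dC (Cg p)).
rewrite mdistxx subr0 ler_norml => /andP[_].
have l0 := hlam.
by have [[-> _//]|[_ ->]] := simplex_cases p q => ?; exfalso; lra.
Qed.

(** If [s < lam - a], adjacent points can only be related to a single point of
[D], hence so can connected ones; then [D] injects into the set of roots. *)
Lemma distortion_ge_lam_sub_a m (beta : 'I_m -> D) : injective beta ->
  (component_number G < m)%N -> lam - a <= s.
Proof.
move=> ibeta km; rewrite leNgt; apply/negP => sla.
have step x y p q : G x y -> C p x -> C q y -> p = q.
  move=> /eqP xy Cpx Cqy; have := dC Cpx Cqy; rewrite ler_norml xy => /andP[_].
  have l0 := hlam.
  by have [[-> _//]|[_ ->]] := simplex_cases p q => ?; exfalso; lra.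
have step0 x p q : C p x -> C q x -> p = q.
  move=> Cpx Cqx; have := dC Cpx Cqx; rewrite ler_norml mdistxx => /andP[_].
  have [/andP[? ?] _ _ _] := hX.
  have l0 := hlam.
  by have [[-> _//]|[_ ->]] := simplex_cases p q => ?; exfalso; lra.
have same x y p q : connect G x y -> C p x -> C q y -> p = q.
  move=> /connectP[l + ->]; elim: l x p => [|z l IH] x p /=.
    by move=> _; exact: step0.
  case/andP=> xz zl Cpx Cq; have [r Crz] := hC.2 z.
  by rewrite (step _ _ _ _ xz Cpx Crz); exact: IH zl Crz Cq.
have [g Cg] := choice hC.1.
have se := distance_graph_sym.
have inj_h : injective (fun i => fingraph.root G (g (beta i))).
  move=> i j /(fingraph.rootP (sym_connect_sym se)) gij.
  exact/ibeta/(same _ _ _ _ gij).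
move: km; rewrite ltnNge => /negP; apply.
rewrite -(card_root_imset se) -[m]card_ord -(card_imset _ inj_h).
apply: subset_leq_card; apply/fintype.subsetP => _ /imsetP[i _ ->].
exact: imset_f.
Qed.

(** If [s < b], labelling the points of [X] by a related point of [D] gives a
covering by at most [m] cliques. *)
Lemma distortion_ge_b m (beta : 'I_m -> D) :
    (forall p, exists i, beta i = p) ->
  (m < clique_covering_number G)%N -> b <= s.
Proof.
move=> sbeta mt; rewrite leNgt; apply/negP => sb.
have /choice[f Cf] : forall x, exists i, C (beta i) x.
  move=> x; have [p Cpx] := hC.2 x.
  by have [i bi] := sbeta p; exists i; rewrite bi.
move: mt; rewrite ltnNge => /negP; apply.
apply: (clique_covering_number_le (f := f)) => x y fxy xy.
rewrite /distance_graph /=.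
have := Cf y; rewrite -fxy => /(distortion_same (Cf x)).
have [[//]|[_ ->]|[_ ->]] := two_distance_cases x y; first by rewrite eqxx.
by move=> ?; exfalso; lra.
Qed.

End LowerBounds.

(** Points in one fibre contribute at most [u] to the distortion; for points in
different fibres [lam] is compared with a distance between [l] and [b]. *)
Lemma gromov_hausdorff_le_labelling (f : X -> D) u l t :
    (forall p, exists x, f x = p) ->
    (forall x y, f x = f y -> mdist x y <= u) ->
    (forall x y, f x <> f y -> l <= mdist x y) ->
    0 < t -> u <= t -> lam - l <= t -> b - lam <= t ->
  (2%:E * gromov_hausdorff_dist D X <= t%:E)%E.
Proof.
move=> sf fu fl t0 ut lt bt.
apply: (@gromov_hausdorff_le _ _ _ (fun p x => p = f x)) => //.
  by split=> [p|x]; [have [x <-] := sf p; exists x|exists (f x)].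
have [/andP[? ?] _ _ _] := hX.
move=> _ _ x y -> ->; rewrite ler_norml; apply/andP.
have [[/fu xy ->]|[/fl xy ->]] := simplex_cases (f x) (f y).
  by have := mdist_ge0 x y; split; lra.
by have [[_ xyE]|[_ xyE]|[_ xyE]] := two_distance_cases x y; split; lra.
Qed.

(** The correspondence is the graph of a left inverse [g] of [h]: two points of
[D] in the same fibre contribute [lam], and otherwise [lam] is compared with
[a] or [b]. *)
Lemma gromov_hausdorff_le_injection (h : X -> D) t : injective h ->
    lam <= t -> b - lam <= t ->
  (2%:E * gromov_hausdorff_dist D X <= t%:E)%E.
Proof.
move=> ih lt bt; have [/andP[? ?] _ [x0 _] _] := hX.
have /choice[g gh] : forall p, exists y, (exists x, h x = p) -> h y = p.
  move=> p; have [[x hx]|nx] := pselect (exists x, h x = p).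
    by exists x.
  by exists x0.
apply: (@gromov_hausdorff_le _ _ _ (fun p x => x = g p)).
- split=> [p|x]; first by exists (g p).
  by exists (h x); apply: ih; rewrite gh//; exists x.
- move=> p q _ _ -> ->; rewrite ler_norml; apply/andP.
  have [[-> ->]|[_ ->]] := simplex_cases p q.
    by rewrite mdistxx; split; lra.
  by have [[_ ->]|[_ ->]|[_ ->]] := two_distance_cases (g p) (g q); split; lra.
- by lra.
Qed.

(** * Values of the distance *)

Section FiniteSimplex.
Variables (m : nat) (beta : 'I_m -> D).
Hypothesis bij_beta : bijective beta.
Local Notation dGH2 := (2%:E * gromov_hausdorff_dist D X)%E.
Local Notation k := (component_number G).
Local Notation theta := (clique_covering_number G).

Lemma simplex_points_eq : m = 1%N -> forall p q : D, p = q.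
Proof.
move=> m1 p q; have [inv _ betaK] := bij_beta.
rewrite -(betaK p) -(betaK q); congr beta; apply: val_inj.
case: (inv p) (inv q) => [i /= +] [j /= +]; rewrite m1.
by case: i j => [|?] [|?].
Qed.

Lemma simplex_points_neq : (1 < m)%N -> exists p q : D, p <> q.
Proof.
move=> m1; exists (beta (Ordinal (ltnW m1))), (beta (Ordinal m1)).
by move=> /(bij_inj bij_beta)/(congr1 val).
Qed.

Lemma gromov_hausdorff_le_finite (f : X -> 'I_m) u l t :
    (forall i, exists x, f x = i) ->
    (forall x y, f x = f y -> mdist x y <= u) ->
    (forall x y, f x <> f y -> l <= mdist x y) ->
    0 < t -> u <= t -> lam - l <= t -> b - lam <= t ->
  (dGH2 <= t%:E)%E.
Proof.
move=> sf fu fl.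
apply: (@gromov_hausdorff_le_labelling (beta \o f)) => [p|x y|x y].
- have [inv _ betaK] := bij_beta; have [x fx] := sf (inv p).
  by exists x; rewrite /= fx betaK.
- by move=> /(bij_inj bij_beta); exact: fu.
- by move=> fxy; apply: fl => fE; apply: fxy; rewrite /= fE.
Qed.

Lemma gromov_hausdorff_point : m = 1%N -> dGH2 = b%:E.
Proof.
move=> m1; have pq := simplex_points_eq m1.
have [/andP[a_gt0 a_lt_b] _ _ [x0 _]] := hX; have l0 := hlam.
apply: gromov_hausdorff_eq; last first.
  by move=> C s hC dC; exact: (distortion_ge_diam_point hC dC pq).
have [p0 _] := hD.1.
(* With a single fibre any lower bound [l] will do; [l = lam] makes [lam - l]
   vanish. *)
apply: (@gromov_hausdorff_le_labelling (fun=> p0) b lam).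
- by move=> p; exists x0; exact: pq.
- by move=> x y _; exact: mdist_le_diam.
- by [].
- exact: lt_trans a_gt0 a_lt_b.
- by [].
- by clear m1; lra.
- by clear m1; lra.
Qed.

Lemma gromov_hausdorff_le_components : (1 < m)%N -> (m <= k)%N ->
  (m < theta)%N -> dGH2 = (Num.max b (lam - b))%:E.
Proof.
move=> m1 mk mt; have l0 := hlam; have [/andP[? ?] _ _ _] := hX.
apply: gromov_hausdorff_eq; last first.
  move=> C s hC dC.
  have [inv _ betaK] := bij_beta.
  have [p [q pq]] := simplex_points_neq m1.
  rewrite ge_max; apply/andP; split; last exact: (distortion_ge_edge hC dC pq).
  by apply: (distortion_ge_b hC dC _ mt) => r; exists (inv r).
have [|f [sf fc _]] := @component_labelling _ _ m distance_graph_sym.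
  by rewrite mk (ltnW m1).
apply: (gromov_hausdorff_le_finite (u := b) (l := b) sf).
- by move=> x y _; exact: mdist_le_diam.
- by move=> x y fxy; apply: mdist_component => /fc.
- by rewrite lt_max; apply/orP; left; lra.
- by rewrite le_max lexx.
- by rewrite le_max lexx orbT.
- by rewrite le_max; apply/orP; left; lra.
Qed.

Lemma gromov_hausdorff_eq_components : k = theta -> m = k ->
  dGH2 = (Num.max (b - lam) (Num.max a (lam - b)))%:E.
Proof.
move=> kt mk; have l0 := hlam; have [/andP[? ?] _ _ [x0 [y0 xy0]]] := hX.
have kn := component_number_lt_card.
have m0 : (0 < m)%N.
  have [p _] := hD.1; have [inv _ _] := bij_beta.
  by case: (inv p) => i; exact: leq_trans.
have [|f [sf fc fconn]] := @component_labelling _ _ m distance_graph_sym.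
  by rewrite mk leqnn -mk m0.
have f_le_a x y : f x = f y -> mdist x y <= a.
  move=> fxy; apply: mdist_le_min.
  apply: (component_clique distance_graph_sym kt).
  by apply: fconn fxy; rewrite mk.
(* Otherwise all points lie in one fibre, although two are at distance [b]. *)
have m1 : (1 < m)%N.
  rewrite ltn_neqAle m0 andbT; apply/eqP => m1.
  suff : mdist x0 y0 <= a by rewrite xy0 leNgt => /negP.
  apply: f_le_a; move: (f x0) (f y0); rewrite -m1 => i j.
  by rewrite !ord1.
apply: gromov_hausdorff_eq; last first.
  move=> C s hC dC.
  have [p [q pq]] := simplex_points_neq m1.
  rewrite !ge_max; apply/and3P; split.
  - exact: (distortion_ge_diam hC dC).
  - by apply: (distortion_ge_a hC dC bij_beta); rewrite mk.
  - exact: (distortion_ge_edge hC dC pq).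
apply: (gromov_hausdorff_le_finite (u := a) (l := b) sf) => //.
- by move=> x y fxy; apply: mdist_component => /fc.
- by rewrite !lt_max; apply/or3P/Or32.
- by rewrite !le_max lexx orbT.
- by rewrite !le_max lexx !orbT.
- by rewrite le_max lexx.
Qed.

Lemma gromov_hausdorff_between : (k < m)%N ->
  (m < theta)%N -> dGH2 = (Num.max b (lam - a))%:E.
Proof.
move=> km mt; have l0 := hlam; have [/andP[? ?] _ _ _] := hX.
apply: gromov_hausdorff_eq; last first.
  move=> C s hC dC.
  have [inv _ betaK] := bij_beta.
  rewrite ge_max; apply/andP; split.
    by apply: (distortion_ge_b hC dC _ mt) => r; exists (inv r).
  exact: (distortion_ge_lam_sub_a hC dC (bij_inj bij_beta) km).
have [|f sf _] := @surjective_refinement X unit (fun=> tt) m.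
  rewrite (leq_trans (ltnW mt) (clique_covering_number_le_card _)) andbT.
  by rewrite (leq_trans (max_card _))// card_unit (leq_trans _ km).
apply: (gromov_hausdorff_le_finite (u := b) (l := a) sf).
- by move=> x y _; exact: mdist_le_diam.
- by move=> x y fxy; apply: mdist_ge_min => xy; apply: fxy; rewrite xy.
- by rewrite lt_max; apply/orP; left; lra.
- by rewrite le_max lexx.
- by rewrite le_max lexx orbT.
- by rewrite le_max; apply/orP; left; lra.
Qed.

Lemma gromov_hausdorff_ge_covering : (k < m)%N -> (theta <= m)%N ->
  (m < #|X|)%N -> dGH2 = (Num.max (b - lam) (Num.max a (lam - a)))%:E.
Proof.
move=> km tm mn; have l0 := hlam; have [/andP[? ?] _ _ _] := hX.
apply: gromov_hausdorff_eq; last first.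
  move=> C s hC dC.
  rewrite !ge_max; apply/and3P; split.
  - exact: (distortion_ge_diam hC dC).
  - exact: (distortion_ge_a hC dC bij_beta mn).
  - exact: (distortion_ge_lam_sub_a hC dC (bij_inj bij_beta) km).
have [c [ct cG]] := clique_labelling G.
have [|f sf fc] := @surjective_refinement X _ c m.
  by rewrite (leq_trans ct tm) ltnW.
apply: (gromov_hausdorff_le_finite (u := a) (l := a) sf).
- by move=> x y fxy; apply: mdist_le_min; apply: cG; exact: fc.
- by move=> x y fxy; apply: mdist_ge_min => xy; apply: fxy; rewrite xy.
- by rewrite !lt_max; apply/or3P/Or32.
- by rewrite !le_max lexx orbT.
- by rewrite !le_max lexx !orbT.
- by rewrite le_max lexx.
Qed.

Lemma gromov_hausdorff_eq_card : m = #|X| ->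
  dGH2 = (Num.max (b - lam) (lam - a))%:E.
Proof.
move=> mn; have l0 := hlam; have [/andP[? ?] _ _ _] := hX.
apply: gromov_hausdorff_eq; last first.
  move=> C s hC dC.
  rewrite ge_max; apply/andP; split; first exact: (distortion_ge_diam hC dC).
  apply: (distortion_ge_lam_sub_a hC dC (bij_inj bij_beta)).
  by rewrite mn component_number_lt_card.
have [|f sf fc] := @surjective_refinement X X id m.
  by rewrite mn card_imset// leqnn.
have t0 : 0 < Num.max (b - lam) (lam - a).
  by rewrite lt_max; have [|] := ltP 0 (b - lam) => //= ?; clear mn; lra.
apply: (gromov_hausdorff_le_finite (u := 0) (l := a) sf) => //.
- by move=> x y /fc ->; rewrite mdistxx.
- by move=> x y fxy; apply: mdist_ge_min => xy; apply: fxy; rewrite xy.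
- exact: ltW.
- by rewrite le_max lexx orbT.
- by rewrite le_max lexx.
Qed.

End FiniteSimplex.

Lemma gromov_hausdorff_gt_card : `I_#|X| #< [set: D] ->
  (2%:E * gromov_hausdorff_dist D X)%E = (Num.max (b - lam) lam)%:E.
Proof.
case/andP=> nD nND; apply: gromov_hausdorff_eq => [|C s hC dC].
  have [h ih] : exists h : 'I_#|X| -> D, injective h.
    by apply/card_le_setTP; rewrite -(card_le_eql card_II).
  apply: (gromov_hausdorff_le_injection (inj_comp ih enum_rank_inj)).
    by rewrite le_max lexx orbT.
  by rewrite le_max lexx.
rewrite ge_max; apply/andP; split; first exact: (distortion_ge_diam hC dC).
rewrite leNgt; apply/negP => slam.
have [g ig] := injection_of_distortion_lt_lam hC dC slam.
move: nND; rewrite card_eq_le nD /= (card_le_eqr card_II) => /negP; apply.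
apply/card_le_setTP; exists (enum_rank \o g).
by apply: inj_comp ig; exact: enum_rank_inj.
Qed.

End TwoDistance.

Lemma finite_setT_ordinal (T : Type) : finite_set [set: T] ->
  exists m (beta : 'I_m -> T), bijective beta /\ [set: T] #= `I_m.
Proof.
move=> /finite_setP[m Tm]; exists m.
have [|beta bij_beta] := @card_eq_setT_bijective 'I_m T; last by exists beta.
by rewrite card_eq_sym (card_eql Tm) card_II.
Qed.

Theorem theorem2p11 (R : realType) (a b lam : R)
    (X : finMetricType R) (D : metricType R)
    (hX : two_distance_space a b X)
    (hlam : 0 < lam) (hD : simplex lam D) :
  let n := #|X| in
  let G := distance_graph a (X := X) in
  let k := component_number G in
  let theta := clique_covering_number G in
  let m_eq j := [set: D] #= `I_j in
  let m_lt j := [set: D] #< `I_j in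
  let m_le j := [set: D] #<= `I_j in
  let m_gt j := `I_j #< [set: D] in
  let m_ge j := `I_j #<= [set: D] in
  let dGH2 := (2%:E * gromov_hausdorff_dist D X)%E in
  (k = theta ->
     (m_eq 1%N -> dGH2 = b%:E) /\
     (m_gt 1%N -> m_lt k -> dGH2 = (Num.max b (lam - b))%:E) /\
     (m_eq k -> dGH2 = (Num.max (b - lam) (Num.max a (lam - b)))%:E) /\
     (m_gt k -> m_lt n ->
        dGH2 = (Num.max (b - lam) (Num.max a (lam - a)))%:E) /\
     (m_eq n -> dGH2 = (Num.max (b - lam) (lam - a))%:E) /\
     (m_gt n -> dGH2 = (Num.max (b - lam) lam)%:E))
  /\
  ((k < theta)%N ->
     (m_eq 1%N -> dGH2 = b%:E) /\
     (m_gt 1%N -> m_le k -> dGH2 = (Num.max b (lam - b))%:E) /\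
     (m_gt k -> m_lt theta -> dGH2 = (Num.max b (lam - a))%:E) /\
     (m_ge theta -> m_lt n ->
        dGH2 = (Num.max (b - lam) (Num.max a (lam - a)))%:E) /\
     (m_eq n -> dGH2 = (Num.max (b - lam) (lam - a))%:E) /\
     (m_gt n -> dGH2 = (Num.max (b - lam) lam)%:E)).
Proof.
move=> n G k theta m_eq m_lt m_le m_gt m_ge dGH2.
have [/finite_setT_ordinal[m [beta [bij_beta Dm]]]|infD] :=
    pselect (finite_set [set: D]); last first.
  have leF j : m_le j -> False.
    by move=> Dj; apply: infD; apply: card_le_finite Dj _; exact: finite_II.
  have eqF j : m_eq j -> False by move=> /card_eqPle[/leF].
  have ltF j : m_lt j -> False by move=> /andP[/leF].
  have gtn := @gromov_hausdorff_gt_card R a b lam X D hX hlam hD.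
  by split=> _; do !split; first [exact: gtn | move=> *; exfalso; eauto].
have eqE j : m_eq j <-> m = j.
  by rewrite /m_eq (card_eql Dm); split=> /card_eq_II.
have leE j : m_le j = (m <= j)%N by rewrite /m_le (card_le_eql Dm) card_le_II.
have geE j : m_ge j = (j <= m)%N by rewrite /m_ge (card_le_eqr Dm) card_le_II.
have ltE j : m_lt j = (m < j)%N.
  rewrite /m_lt (card_le_eql Dm) (card_eql Dm) card_le_II ltn_neqAle andbC.
  by congr (~~ _ && _); apply/card_eq_II/eqP.
have gtE j : m_gt j = (j < m)%N.
  rewrite /m_gt (card_le_eqr Dm) (card_eqr Dm) card_le_II ltn_neqAle andbC.
  by congr (~~ _ && _); apply/card_eq_II/eqP.
rewrite !leE !geE !ltE !gtE.
split=> kt; do !split=> //.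
- by move=> /eqE; exact: (gromov_hausdorff_point hX hlam hD bij_beta).
- by move=> m1 mk;
  apply: (gromov_hausdorff_le_components hX hlam hD bij_beta) => //;
  rewrite ?(ltnW mk)// -/theta -kt.
- by move=> /eqE;
  exact: (gromov_hausdorff_eq_components hX hlam hD bij_beta kt).
- by move=> km mn;
  apply: (gromov_hausdorff_ge_covering hX hlam hD bij_beta) => //;
  rewrite -/theta -kt ltnW.
- by move=> /eqE; exact: (gromov_hausdorff_eq_card hX hlam hD bij_beta).
- by move=> nD;
  apply: (gromov_hausdorff_gt_card hX hlam hD); rewrite -/(m_gt n) gtE.
- by move=> /eqE; exact: (gromov_hausdorff_point hX hlam hD bij_beta).
- by move=> m1 mk;
  apply: (gromov_hausdorff_le_components hX hlam hD bij_beta) => //;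
  exact: leq_ltn_trans mk kt.
- by move=> km mt; exact: (gromov_hausdorff_between hX hlam hD bij_beta).
- by move=> tm mn;
  apply: (gromov_hausdorff_ge_covering hX hlam hD bij_beta) => //;
  exact: leq_trans kt tm.
- by move=> /eqE; exact: (gromov_hausdorff_eq_card hX hlam hD bij_beta).
- by move=> nD;
  apply: (gromov_hausdorff_gt_card hX hlam hD); rewrite -/(m_gt n) gtE.
Qed.
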